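(* For every fixed integer $k\ge 2$, as $n\to\infty$, \[ g_k(n)\le (k-1)\log_2 n+\log_2\log n+O_k(1). \] Equivalently, \[ g_k(n)\le \frac{k-1}{\log 2}\log n+\frac{1}{\log 2}\log\log n+O_k(1). \]
   Context: $\mathbb N=\{1,2,3,\ldots\}$, $\log$ is the natural logarithm and $\log_2$ is the logarithm to base $2$. For a fixed integer $k\ge 2$ and $n\in\mathbb N$, \[ g_k(n)=\max\{a_1+\cdots+a_k-n:\ a_1!\cdots a_k!\mid n!,\ a_i\in\mathbb N\}. \] The constant implied by $O_k(1)$ depends only on $k$. *)

(* Defs.v *)
From mathcomp Require Import all_boot all_order all_algebra.
From mathcomp Require Import all_classical all_reals all_analysis.

Set Implicit Arguments.
Unset Strict Implicit.
Unset Printing Implicit Defensive.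

Import Order.TTheory GRing.Theory Num.Theory.

Definition admissible (k n : nat) (a : 'I_k -> nat) : bool :=
  [forall i, (0 < a i)%N] && (\prod_(i < k) (a i)`! %| n`!)%N.

(* Restricting the entries to values at most n makes the range of the maximum
   finite and loses nothing: see admissible_le and g_spec. *)
Definition g (k n : nat) : int :=
  ((\max_(a : {ffun 'I_k -> 'I_n.+1} | admissible n (fun i => a i : nat))
      \sum_(i < k) (a i : nat))%N%:Z - n%:Z)%R.

Definition log2 (R : realType) (x : R) : R := (ln x / ln 2)%R.

Lemma admissible_le (k n : nat) (a : 'I_k -> nat) :
  (0 < n)%N -> admissible n a -> forall i, (a i <= n)%N.
Proof.
move=> n0 /andP[_ /dvdn_leq-/(_ (fact_gt0 n)) aP] i.
rewrite leqNgt; apply/negP => nai.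
have : (n`! < \prod_(i < k) (a i)`!)%N; last by rewrite ltnNge aP.
rewrite (bigD1 i) //=; apply: (@leq_trans (a i)`!).
  by rewrite ltn_fact.
by apply: leq_pmulr; apply: prodn_gt0 => j; exact: fact_gt0.
Qed.

Lemma g_spec (k n : nat) : (0 < k)%N -> (0 < n)%N ->
  (exists2 a : 'I_k -> nat, admissible n a &
     g k n = ((\sum_(i < k) a i)%N%:Z - n%:Z)%R) /\
  (forall a : 'I_k -> nat, admissible n a ->
     ((\sum_(i < k) a i)%N%:Z - n%:Z <= g k n)%R).
Proof.
move=> k0 n0; split.
  have n1 : (1 < n.+1)%N by [].
  pose a1 : {ffun 'I_k -> 'I_n.+1} := [ffun=> Ordinal n1].
  have a1P : admissible n (fun i => a1 i : nat).
    apply/andP; split; first by apply/forallP => i; rewrite ffunE.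
    by rewrite big1 ?dvd1n // => i _; rewrite ffunE.
  have [|a aP aE] := @eq_bigmax_cond _
    (fun a : {ffun 'I_k -> 'I_n.+1} => admissible n (fun i => a i : nat))
    (fun a => \sum_(i < k) (a i : nat))%N.
    by apply/card_gt0P; exists a1.
  by exists (fun i => a i : nat) => //; rewrite /g aE.
move=> a aP; rewrite /g lerD2r lez_nat.
pose b : {ffun 'I_k -> 'I_n.+1} := [ffun i => inord (a i)].
have bE i : (b i : nat) = a i.
  by rewrite ffunE inordK // ltnS (admissible_le n0 aP).
rewrite (_ : \sum_(i < k) a i = \sum_(i < k) (b i : nat))%N; last first.
  by apply: eq_bigr => i _; rewrite bE.
apply: (@leq_bigmax_cond _
  (fun a : {ffun 'I_k -> 'I_n.+1} => admissible n (fun i => a i : nat))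
  (fun a => \sum_(i < k) (a i : nat))%N).
by rewrite (_ : (fun i => b i : nat) = a) //; apply/funext.
Qed.

(* Main.v *)
Require Import Defs.
From mathcomp Require Import all_boot all_order all_algebra.
From mathcomp Require Import all_classical all_reals all_analysis.
From mathcomp Require Import zify ring lra.

(** The proof compares valuations at the prime 2.  Write [N] for the sum of the [a i] and
    [D = N - n] for the excess to be bounded, with [N > n].  Two divisibilities,
    [D! * n! | N!] and [\prod_i (a i)! | n!], give
      [v_2(D!) <= v_2(N!) - v_2(n!) <= v_2(N!) - \sum_i v_2((a i)!)].
    The right-hand side is the 2-adic valuation of a multinomial coefficient
    with [k] parts.  In Legendre's formula each power [2 ^ j <= N] contributes
    at most [k - 1] to it (the carries when [k] numbers are added), so it is at
    most [(k - 1) log_2 N] (lemma [logn_fact_sum]).  The left-hand side is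
    almost [D]: it is at least [D - log_2 D - 1] (lemma [leq_logn2_fact]).
    Since every [a i] is at most [n], [N <= k n], whence
      [D <= (k - 1) log_2 (k n) + log_2 D + 1].
    A first use of this inequality shows that [D] is [O_k(log n)]; putting that
    back into [log_2 D] produces the term [log_2 log n].

    The passage from the trivial [k log_2 n], which comes from comparing the
    valuations of [\prod_i (a i)!] and [n!] by counting binary digits, to
    [(k - 1) log_2 n] is due to the comparison with [N!]: the binary digit
    sums of [n] and of the [a i] are correlated, because [n] differs from the
    sum of the [a i] only by the logarithmically small [D]. *)

Import Order.TTheory GRing.Theory Num.Theory.
Local Open Scope classical_set_scope.
Local Open Scope ring_scope.

Lemma sum_divn_expn_trunc (p n M : nat) :
  (1 < p)%N -> (n < p ^ M)%N ->
  forall d, (\sum_(1 <= j < (M + d).+1) n %/ p ^ j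
             = \sum_(1 <= j < M) n %/ p ^ j)%N.
Proof.
move=> p1 nM.
have tail M' : (M <= M')%N ->
    (\sum_(1 <= j < M'.+1) n %/ p ^ j = \sum_(1 <= j < M') n %/ p ^ j)%N.
  case: M' => [|M'] MM'; first by rewrite !big_geq.
  rewrite big_nat_recr //= divn_small ?addn0 //.
  by apply: leq_trans nM _; rewrite leq_exp2l.
elim=> [|d IH]; first by rewrite addn0 tail.
by rewrite tail ?leq_addr // addnS.
Qed.

(** Legendre's formula with the summation range free: factorials of different
    numbers can then be compared term by term over a common range. *)
Lemma logn_fact_trunc (p n M : nat) : prime p -> (n < p ^ M)%N ->
  logn p n`! = (\sum_(1 <= j < M) n %/ p ^ j)%N.
Proof.
move=> pp nM; have p1 := prime_gt1 pp.
have nn : (n < p ^ n.+1)%N := ltn_trans (ltnSn n) (ltn_expl n.+1 p1).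
rewrite logn_fact // -(sum_divn_expn_trunc p n M p1 nM n.+1).
by rewrite -(sum_divn_expn_trunc p n n.+1 p1 nn M) addnC.
Qed.

(** Legendre's identity [v_2(n!) = n - s_2(n)], where the number [s_2(n)] of
    ones in base 2 is at most the number [L] of digits.  Digits are avoided by
    summing [q_j <= 2 q_(j+1) + 1] over [j < L] for the quotients
    [q_j = n %/ 2 ^ j]: as [q_L = 0], the sum collapses to
    [q_0 <= \sum_(1 <= j < L) q_j + L]. *)
Lemma leq_logn2_fact (n L : nat) : (n < 2 ^ L)%N -> (n <= logn 2 n`! + L)%N.
Proof.
move=> nL; rewrite (logn_fact_trunc 2 n L.+1) //; last first.
  by apply: leq_trans nL _; rewrite leq_exp2l.
have : (\sum_(0 <= j < L) n %/ 2 ^ j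
        <= \sum_(0 <= j < L) ((n %/ 2 ^ j.+1).*2 + 1))%N.
  by apply: leq_sum => j _; rewrite expnSr divnMA; lia.
have -> : (\sum_(0 <= j < L) ((n %/ 2 ^ j.+1).*2 + 1)
           = (\sum_(1 <= j < L.+1) n %/ 2 ^ j).*2 + L)%N.
  rewrite big_split /= sum_nat_const_nat muln1 subn0 big_add1 /=.
  by congr addn; rewrite -muln2 big_distrl; apply: eq_bigr => j _; rewrite -muln2.
have : (\sum_(0 <= j < L.+1) n %/ 2 ^ j
        = n + \sum_(1 <= j < L.+1) n %/ 2 ^ j)%N.
  by rewrite big_ltn // expn0 divn1.
rewrite big_nat_recr //= divn_small // addn0 => ->.
lia.
Qed.

(** The [k] remainders add up to at most [k (d - 1) < k d], so that they carry
    at most [k - 1] into the quotient. *)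
Lemma leq_divn_sum (k d : nat) (a : 'I_k -> nat) : (0 < k)%N -> (0 < d)%N ->
  ((\sum_(i < k) a i) %/ d <= \sum_(i < k) (a i %/ d) + k.-1)%N.
Proof.
move=> k0 d0.
have : (\sum_(i < k) (a i).+1 <= \sum_(i < k) (a i %/ d).+1 * d)%N.
  by apply: leq_sum => i _; exact: ltn_ceil.
rewrite -big_distrl /=.
have sumS (b : 'I_k -> nat) :
    (\sum_(i < k) (b i).+1 = \sum_(i < k) b i + k)%N.
  under eq_bigr do rewrite -addn1.
  by rewrite big_split /= sum_nat_const card_ord muln1.
rewrite !sumS => H.
rewrite -ltnS -addnS prednK // ltn_divLR //.
by apply: leq_trans H; rewrite -addn1 leq_add2l.
Qed.

(** The valuation of a multinomial coefficient with [k] parts, in a subtraction-free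
    form: each of the [M - 1] exponents [j] that can occur in Legendre's
    formula contributes at most [k - 1]. *)
Lemma logn_fact_sum (p k M : nat) (a : 'I_k -> nat) :
  prime p -> (0 < k)%N -> (\sum_(i < k) a i < p ^ M)%N ->
  (logn p (\sum_(i < k) a i)`!
   <= \sum_(i < k) logn p (a i)`! + k.-1 * M.-1)%N.
Proof.
move=> pp k0 NM; rewrite (logn_fact_trunc p _ M) //.
rewrite [X in (_ <= X + _)%N](eq_bigr (fun i => \sum_(1 <= j < M) a i %/ p ^ j)%N);
  last first.
  move=> i _; apply: logn_fact_trunc => //.
  by apply: leq_ltn_trans NM; rewrite (bigD1 i) //= leq_addr.
rewrite exchange_big /= mulnC -subn1 -sum_nat_const_nat -big_split /=.
by apply: leq_sum => j _; apply: leq_divn_sum; rewrite // expn_gt0 prime_gt0.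
Qed.

Lemma logn_prod_fact (p k : nat) (a : 'I_k -> nat) :
  logn p (\prod_(i < k) (a i)`!) = (\sum_(i < k) logn p (a i)`!)%N.
Proof.
suff [] : (0 < \prod_(i < k) (a i)`!)%N /\
   logn p (\prod_(i < k) (a i)`!) = (\sum_(i < k) logn p (a i)`!)%N by [].
apply: (big_ind2 (fun x y => (0 < x)%N /\ logn p x = y)); first by rewrite logn1.
  by move=> x1 y1 x2 y2 [x0 <-] [y0 <-]; rewrite lognM // muln_gt0 x0.
by move=> i _; rewrite fact_gt0.
Qed.

Lemma logn_fact_subn (p m n : nat) : (n <= m)%N ->
  (logn p (m - n)`! + logn p n`! <= logn p m`!)%N.
Proof.
move=> nm; rewrite addnC -lognM ?fact_gt0 // dvdn_leq_log ?fact_gt0 //.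
by rewrite -(bin_fact nm) dvdn_mull.
Qed.

(** The arithmetic content of the theorem.  The witness [t] is the integer part
    of [log_2 D] for the excess [D]; its second bound is what turns [log_2 D]
    into [log_2 log n + O_k(1)]. *)
Lemma excess_bound (k n : nat) (a : 'I_k -> nat) :
  (2 <= k)%N -> (0 < n)%N -> admissible n a ->
  let m := trunc_log 2 (k * n) in
  exists t, (\sum_(i < k) a i - n <= k.-1 * m + t.+1)%N
            /\ (2 ^ t <= 2 * k * m)%N.
Proof.
move=> k2 n0 aP m.
set N := (\sum_(i < k) a i)%N; set D := (N - n)%N.
have m0 : (0 < m)%N by rewrite trunc_log_gt0 /= ; nia.
have k0 : (0 < k)%N by lia.
have Dle L : (D < 2 ^ L)%N -> (D <= k.-1 * m + L)%N.
  move=> DL; have [Nn|nN] := leqP N n; first by rewrite /D (eqP Nn).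
  have Nkn : (N <= k * n)%N.
    rewrite -[X in (X * n)%N](card_ord k) -sum_nat_const.
    by apply: leq_sum => i _; exact: admissible_le.
  have NM : (N < 2 ^ m.+1)%N.
    by apply: leq_ltn_trans Nkn _; rewrite trunc_log_ltn.
  have := logn_fact_sum 2 k m.+1 a isT k0 NM.
  have := logn_fact_subn 2 N n (ltnW nN).
  have /andP[_ /dvdn_leq_log-/(_ 2%N (fact_gt0 n))] := aP.
  rewrite logn_prod_fact; have := leq_logn2_fact D L DL.
  rewrite -/N -/D /=; lia.
have tD : (D < 2 ^ (trunc_log 2 D).+1)%N by exact: trunc_log_ltn.
exists (trunc_log 2 D); split; first exact: Dle.
case tE : (trunc_log 2 D) => [|t]; first by rewrite expn0 !muln_gt0 k0 m0.
have D0 : (0 < D)%N by case: (D) tE => //; rewrite trunc_log0.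
have := trunc_logP (isT : 1 < 2)%N D0; have := Dle _ tD.
(* With [t.+1] for [log_2 D], the first bound reads
   [2 ^ t.+1 <= D <= k.-1 * m + t.+2]; as [t.+1 <= 2 ^ t], half of the left-hand
   side absorbs [t.+1], leaving [2 ^ t <= k.-1 * m + 1 <= k * m]. *)
have := ltn_expl t (isT : 1 < 2)%N.
by rewrite tE expnS; nia.
Qed.

(** An explicit constant, valid from [n = k] on: that hypothesis gives
    [log_2 (k n) <= 2 log_2 n], which makes [2 ^ t] in [excess_bound] at most
    [(4 k / ln 2) ln n]. *)
Lemma g_upper (R : realType) (k n : nat) : (2 <= k)%N -> (k <= n)%N ->
  (g k n)%:~R <= (k%:R - 1) * log2 (n%:R : R) + log2 (ln (n%:R : R))
    + ((k%:R - 1) * log2 (k%:R : R) + 1 + log2 (4 * k%:R / ln 2 : R)).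
Proof.
move=> k2 kn.
have n0 : (0 < n)%N by lia.
have k0 : (0 < k)%N by lia.
have [[a aP ->] _] := g_spec k0 n0.
have [t [Dt tm]] := excess_bound k n a k2 n0 aP.
set m := trunc_log 2 (k * n) in Dt tm.
have ln2 : 0 < ln (2 : R) by rewrite ln_gt0 // ltr1n.
have kR : 0 < (k%:R : R) by rewrite ltr0n.
have nR : 0 < (n%:R : R) by rewrite ltr0n.
have lnn : 0 < ln (n%:R : R) by rewrite ln_gt0 // ltr1n; lia.
have pow2 s x : (0 < x)%N -> (2 ^ s <= x)%N -> s%:R * ln (2 : R) <= ln x%:R.
  move=> x0 sx; rewrite mulr_natl -lnXn // ler_ln ?posrE ?exprn_gt0 ?ltr0n //.
  by rewrite -natrX ler_nat.
have mk : m%:R * ln (2 : R) <= ln k%:R + ln n%:R.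
  rewrite -lnM ?posrE // -natrM; apply: pow2; first by rewrite muln_gt0 k0.
  by apply: trunc_logP => //; rewrite muln_gt0 k0.
have m2 : m%:R <= 2 * ln n%:R / ln (2 : R).
  rewrite ler_pdivlMr //; apply: (le_trans mk).
  have : ln k%:R <= ln (n%:R : R) by rewrite ler_ln ?posrE // ler_nat.
  lra.
have t2 : t%:R * ln (2 : R) <= ln (4 * k%:R / ln 2) + ln (ln n%:R).
  have km0 : (0 < 2 * k * m)%N by apply: leq_trans tm; rewrite expn_gt0.
  apply: le_trans (pow2 _ _ km0 tm) _.
  rewrite -lnM ?posrE ?divr_gt0 ?mulr_gt0 //.
  rewrite ler_ln ?posrE ?ltr0n ?mulr_gt0 ?invr_gt0 //.
  rewrite 2!natrM.
  have -> : 4 * k%:R / ln 2 * ln n%:R = 2 * k%:R * (2 * ln n%:R / ln (2 : R)).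
    by rewrite -[4]/((2 + 2)%:R) natrD; ring.
  by rewrite ler_pM2l // mulr_gt0.
have Dt' : ((\sum_(i < k) a i)%N%:Z - n%:Z)%:~R <= (k%:R - 1) * m%:R + t%:R + 1 :> R.
  have -> : (k%:R - 1) * m%:R + t%:R + 1 = (k.-1 * m + t.+1)%N%:~R :> R.
    by rewrite -[in LHS](prednK k0) -!natr1 -pmulrn !natrD natrM -natr1; ring.
  by rewrite ler_int; lia.
apply: (le_trans Dt').
have mE : m%:R <= log2 (k%:R : R) + log2 (n%:R : R).
  by rewrite /log2 -mulrDl ler_pdivlMr.
have tE : t%:R <= log2 (4 * k%:R / ln 2 : R) + log2 (ln (n%:R : R)).
  by rewrite /log2 -mulrDl ler_pdivlMr.
have k1 : 0 <= k%:R - 1 :> R by rewrite subr_ge0 ler1n.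
have := ler_wpM2l k1 mE; lra.
Qed.

Theorem theorem1p2 (R : realType) (k : nat) (hk : (2 <= k)%N) :
  (exists C : R, \forall n \near \oo,
     (g k n)%:~R <= (k%:R - 1) * log2 (n%:R : R) + log2 (ln (n%:R : R)) + C)
  /\
  (exists C : R, \forall n \near \oo,
     (g k n)%:~R <= (k%:R - 1) / ln (2 : R) * ln (n%:R : R)
                    + 1 / ln (2 : R) * ln (ln (n%:R : R)) + C).
Proof.
set C : R := (k%:R - 1) * log2 k%:R + 1 + log2 (4 * k%:R / ln 2).
split; exists C; exists k => // n /= kn; first exact: g_upper.
have := g_upper R k n hk kn; rewrite /log2 -/C => H.
by rewrite mul1r mulrAC [X in _ + X + _]mulrC -mulrA.
Qed.
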